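(* Let $(N,\mathcal{W})$ be a simple game with $N=\{1,\dots,n\}$. (a) $\nu(N,\mathcal{W})\ge\left\lceil\frac{1}{e^\star}\right\rceil$, where $e^\star$ is the minimum maximum excess of the game. (b) $\nu(N,\mathcal{W})\ge\left\lceil\frac{1+\Delta}{\Delta}\right\rceil=\left\lceil\frac{1}{1-q^\star}\right\rceil$, where $\Delta$ is the price of stability of the game and $q^\star=1-e^\star$. Here $x/0$ is interpreted as $\infty$.
   Context: A simple game $(N,\mathcal{W})$: $\mathcal{W}$ a family of subsets of $N$ (winning coalitions) with $\emptyset\notin\mathcal{W}$, $N\in\mathcal{W}$, closed under supersets; $\nu(N,\mathcal{W})$ is the minimum number of winning coalitions with empty intersection ($\infty$ if none). For $w\in\mathbb{R}^n$ and $S\subseteq N$ write $w(S)=\sum_{i\in S}w_i$. The minimum maximum excess $e^\star$ is the optimal value of the linear program: minimize $1-q$ over $q\in\mathbb{R}$, $w\in\mathbb{R}^n_{\ge0}$ subject to $w(N)=1$ and $w(S)\ge q$ for all $S\in\mathcal{W}$. The price of stability $\Delta$ is the optimal value of: minimize $\Delta$ over $\Delta\ge0$, $w'\in\mathbb{R}^n_{\ge0}$ subject to $w'(N)=1+\Delta$ and $w'(S)\ge1$ for all $S\in\mathcal{W}$. *)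

(* Defs.v *)
From HB Require Import structures.
From mathcomp Require Import all_boot all_order all_algebra.
From mathcomp Require Import boolp classical_sets reals constructive_ereal.

Set Implicit Arguments.
Unset Strict Implicit.
Unset Printing Implicit Defensive.

Import Order.TTheory GRing.Theory Num.Theory.

Local Open Scope ring_scope.
Local Open Scope classical_set_scope.

(* The player set N = {1, ..., n} is encoded by the type 'I_n. *)
Definition simple_game (n : nat) (W : {set {set 'I_n}}) : Prop :=
  [/\ finset.set0 \notin W,
      [set: 'I_n]%SET \in W
    & forall S T : {set 'I_n}, S \in W -> S \subset T -> T \in W].

(* The big minimum is +oo when no subfamily of W has empty intersection; the
   intersection of the empty subfamily is the whole player set. *)
Definition nakamura (R : realType) (n : nat) (W : {set {set 'I_n}}) : \bar R :=
  \big[mine/+oo%E]_(F : {set {set 'I_n}} |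
      (F \subset W) && ((\bigcap_(S in F) S)%SET == finset.set0))
    (#|F|%:R)%:E.

Definition weight (R : realType) (n : nat) (w : 'I_n -> R) (S : {set 'I_n}) : R :=
  \sum_(i in S) w i.

Definition excess_feasible (R : realType) (n : nat) (W : {set {set 'I_n}})
    (q : R) (w : 'I_n -> R) : Prop :=
  [/\ forall i, 0 <= w i,
      weight w [set: 'I_n]%SET = 1
    & forall S : {set 'I_n}, S \in W -> q <= weight w S].

Definition excess_values (R : realType) (n : nat) (W : {set {set 'I_n}}) : set R :=
  [set e | exists q w, excess_feasible W q w /\ e = 1 - q].

(* On a simple game the infimum is that of a nonempty set bounded below, see
   [has_inf_excess_values]. *)
Definition min_max_excess (R : realType) (n : nat) (W : {set {set 'I_n}}) : R :=
  inf (@excess_values R n W).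

Definition stability_feasible (R : realType) (n : nat) (W : {set {set 'I_n}})
    (D : R) (w : 'I_n -> R) : Prop :=
  [/\ 0 <= D,
      forall i, 0 <= w i,
      weight w [set: 'I_n]%SET = 1 + D
    & forall S : {set 'I_n}, S \in W -> 1 <= weight w S].

Definition stability_values (R : realType) (n : nat) (W : {set {set 'I_n}}) : set R :=
  [set D | exists w, stability_feasible W D w].

(* See [has_inf_stability_values]. *)
Definition price_of_stability (R : realType) (n : nat) (W : {set {set 'I_n}}) : R :=
  inf (@stability_values R n W).

Definition eceil (R : realType) (x : \bar R) : \bar R := er_map (@Rceil R) x.

(* Division on \bar R satisfies 0^-1 = +oo, hence x / 0 = +oo for x > 0. *)
Lemma divide0 (R : realType) (x : R) : 0 < x -> (x%:E / 0%:E = +oo :> \bar R)%E.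
Proof. by move=> x0; rewrite inve0 gt0_muley. Qed.

Lemma simple_game_gt0 (n : nat) (W : {set {set 'I_n}}) : simple_game W -> (0 < n)%N.
Proof.
case: n W => // W [W0 WT _]; move: W0.
suff -> : finset.set0 = [set: 'I_0]%SET by rewrite WT.
by apply/setP => -[].
Qed.

Lemma has_inf_excess_values (R : realType) (n : nat) (W : {set {set 'I_n}}) :
  simple_game W -> has_inf (@excess_values R n W).
Proof.
move=> gW; have n0 := simple_game_gt0 gW; case: gW => W0 WT Wup; split.
  exists 1, 0, (fun=> n%:R^-1); split; last by rewrite subr0.
  split=> [i||S _]; first by rewrite invr_ge0.
    rewrite /weight sumr_const cardsT card_ord -[RHS](@mulfV _ n%:R); last first.
      by rewrite pnatr_eq0 -lt0n.
    by rewrite mulr_natl.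
  by apply: sumr_ge0 => i _; rewrite invr_ge0.
exists 0 => _ [q [w [[_ w1 qw] ->]]].
by rewrite subr_ge0 -w1; apply: qw.
Qed.

Lemma has_inf_stability_values (R : realType) (n : nat) (W : {set {set 'I_n}}) :
  simple_game W -> has_inf (@stability_values R n W).
Proof.
move=> gW; have n0 := simple_game_gt0 gW; case: gW => W0 WT Wup; split.
  exists (n%:R - 1), (fun=> 1); split=> [|//||S SW].
  - by rewrite subr_ge0 ler1n.
  - by rewrite /weight sumr_const cardsT card_ord addrC subrK.
  - rewrite /weight sumr_const ler1n card_gt0.
    by apply: contraNneq W0 => <-.
by exists 0 => D [w []].
Qed.

(* Main.v *)
Require Import Defs.
From HB Require Import structures.
From mathcomp Require Import all_boot all_order all_algebra.
From mathcomp Require Import boolp classical_sets reals constructive_ereal.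
From mathcomp Require Import ring lra.

Set Implicit Arguments.
Unset Strict Implicit.
Unset Printing Implicit Defensive.

Import Order.TTheory GRing.Theory Num.Theory.

Local Open Scope ring_scope.

(** If coalitions [S_1, ..., S_k] have empty intersection, their complements
    cover [N]; since a complement weighs at most [1 - q] in any feasible
    solution, [1 <= k * (1 - q)], and passing to the infimum gives
    [1 / e <= k]. Rescaling a feasible [w] by [1 / q] (resp. [w'] by
    [1 / (1 + D)]) exchanges the two programs and yields [e = D / (1 + D)], so
    that the two fractions coincide. *)

Section Weights.
Variables (R : realType) (n : nat) (w : 'I_n -> R).

Lemma weightC (S : {set 'I_n}) :
  weight w (~: S) = weight w [set: 'I_n] - weight w S.
Proof.
rewrite /weight [in RHS](big_setID S)/= finset.setTI finset.setTD.
by rewrite addrAC subrr add0r.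
Qed.

Lemma weight_divr (c : R) (S : {set 'I_n}) :
  weight (fun i => w i / c) S = weight w S / c.
Proof. by rewrite /weight mulr_suml. Qed.

Lemma weight_bigcup_le (I : finType) (P : {set I}) (A : I -> {set 'I_n}) :
    (forall i, 0 <= w i) ->
  weight w (\bigcup_(j in P) A j) <= \sum_(j in P) weight w (A j).
Proof.
move=> w0.
elim/big_ind2: _ => [|x B y C Bx Cy|//]; first by rewrite /weight big_set0.
(* Split [B :|: C] into [B] and [C :\: B]; the second piece weighs at most as much as [C] because
   weights are nonnegative. *)
apply: le_trans (lerD Bx Cy); rewrite /weight (big_setID B)/=.
rewrite finset.setIUl finset.setIid (finset.setUidPl _) ?finset.subsetIr//.
rewrite lerD2l finset.setDUl finset.setDv finset.set0U [leRHS](big_setID B)/=.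
by rewrite lerDr sumr_ge0.
Qed.

End Weights.

Section Programs.
Variables (R : realType) (n : nat) (W : {set {set 'I_n}}).

Lemma excess_values_ge0 (e : R) :
  simple_game W -> excess_values W e -> 0 <= e.
Proof.
by case=> _ WT _ [q [w [[_ w1 qw] ->]]]; rewrite subr_ge0 -w1; apply: qw.
Qed.

(** The bound [e < 1] makes the threshold [q = 1 - e] positive, so weights can be divided by it; the
    total becomes [1 / q = 1 + e / (1 - e)]. *)
Lemma excess_stability_values (e : R) :
    simple_game W -> excess_values W e -> e < 1 ->
  stability_values W (e / (1 - e)).
Proof.
move=> gW eW e1; have e0 := excess_values_ge0 gW eW.
case: eW => q [w [[w0 w1 qw] eE]].
have qE : 1 - e = q by lra.
have q0 : 0 < q by lra.
rewrite qE; exists (fun i => w i / q); split.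
- by rewrite divr_ge0// ltW.
- by move=> i; rewrite divr_ge0// ltW.
- by rewrite weight_divr w1 eE; field; rewrite gt_eqF.
- by move=> S SW; rewrite weight_divr ler_pdivlMr// mul1r; apply: qw.
Qed.

(** Dividing by the total weight [1 + D] lowers the threshold from [1] to [1 / (1 + D)]. *)
Lemma stability_excess_values (D : R) :
  stability_values W D -> excess_values W (D / (1 + D)).
Proof.
move=> [w [D0 w0 wT wS]]; have D1 : 0 < 1 + D by lra.
exists (1 / (1 + D)), (fun i => w i / (1 + D)); split; last first.
  by field; rewrite gt_eqF.
split.
- by move=> i; rewrite divr_ge0// ltW.
- by rewrite weight_divr wT divff// gt_eqF.
- by move=> S SW; rewrite weight_divr ler_pM2r ?invr_gt0//; apply: wS.
Qed.

Lemma stability_values_ge0 (D : R) : stability_values W D -> 0 <= D.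
Proof. by case=> w []. Qed.

Hypothesis gW : simple_game W.

Lemma price_of_stability_ge0 : 0 <= price_of_stability R W.
Proof.
apply: lb_le_inf; first by case: (has_inf_stability_values R gW).
by move=> D; exact: stability_values_ge0.
Qed.

(** Each inequality shows that the rescaled infimum of one program is a lower bound for the values
    of the other, so no optimal solution has to be exhibited. *)
Lemma min_max_excessE :
  min_max_excess R W = price_of_stability R W / (1 + price_of_stability R W).
Proof.
have D0 := price_of_stability_ge0.
have [E_neq0 E_lb] := has_inf_excess_values R gW.
have [V_neq0 V_lb] := has_inf_stability_values R gW.
set e := min_max_excess R W; set D := price_of_stability R W in D0 *.
have D1 : 0 < 1 + D by lra.
have e_le x : stability_values W x -> e * (1 + x) <= x.
  move=> xV; have x0 := stability_values_ge0 xV.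
  rewrite -ler_pdivlMr; last by lra.
  by apply: ge_inf => //; apply: stability_excess_values.
(* Any feasible [x] gives [e <= x / (1 + x) < 1]; this allows division by [1 - e] below. *)
have e1 : e < 1.
  case: V_neq0 => x xV; have := e_le x xV; have := stability_values_ge0 xV.
  by nra.
apply/eqP; rewrite eq_le ler_pdivlMr// ler_pdivrMr//; apply/andP; split.
  suff : e / (1 - e) <= D by rewrite ler_pdivrMr; lra.
  apply: lb_le_inf => // x /e_le ex; rewrite ler_pdivrMr; lra.
rewrite -ler_pdivrMr//; apply: lb_le_inf => // x xE.
have x0 := excess_values_ge0 gW xE; rewrite ler_pdivrMr//.
(* Rescaling applies only when [x < 1]; otherwise [D / (1 + D) < 1 <= x]. *)
have [x1|x1] := ltP x 1; last by nra.
suff : D <= x / (1 - x) by rewrite ler_pdivlMr; lra.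
by apply: ge_inf => //; apply: excess_stability_values.
Qed.

Lemma inv_card_le_min_max_excess (F : {set {set 'I_n}}) :
    F \subset W -> (\bigcap_(S in F) S = finset.set0)%SET ->
  #|F|%:R^-1 <= min_max_excess R W.
Proof.
move=> FW F0; apply: lb_le_inf; first by case: (has_inf_excess_values R gW).
move=> _ [q [w [[w0 w1 qw] ->]]].
have cover : (\bigcup_(S in F) ~: S = [set: 'I_n])%SET.
  by rewrite -finset.setC_bigcap F0 finset.setC0.
have : 1 <= #|F|%:R * (1 - q).
  rewrite -[leLHS]w1 -[X in weight w X <= _]cover.
  apply: le_trans (weight_bigcup_le _ _ w0) _.
  rewrite mulr_natl -sumr_const; apply: ler_sum => S SF.
  by rewrite weightC w1 lerD2l lerN2 qw// (fintype.subsetP FW).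
(* For empty [F] the bound just proved would read [1 <= 0]. *)
have [->|F_gt0] := posnP #|F|; first by rewrite mul0r ler10.
by rewrite -ler_pdivrMl ?ltr0n// mulr1.
Qed.

End Programs.

Lemma eceil_inv_min_max_excess_le (R : realType) (n : nat)
    (W : {set {set 'I_n}}) :
  simple_game W -> (eceil (1%:E / (min_max_excess R W)%:E) <= nakamura R W)%E.
Proof.
move=> gW; apply/bigmin_geP; split=> [|F /andP[FW /eqP F0]]; first exact: leey.
have Fe := inv_card_le_min_max_excess R gW FW F0.
(* The empty family intersects to all of ['I_n], which has a player since [n > 0]. *)
have F_gt0 : (0 < #|F|)%N.
  rewrite lt0n; apply/eqP => /eqP; rewrite cards_eq0 => /eqP FE.
  move: F0; rewrite FE big_set0 => /setP/(_ (Ordinal (simple_game_gt0 gW))).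
  by rewrite !inE.
have e_gt0 : 0 < min_max_excess R W.
  by apply: lt_le_trans Fe; rewrite invr_gt0 ltr0n.
rewrite inver gt_eqF// -EFinM mul1r lee_fin RceilE.
(* As [#|F|] is an integer, bounding the ceiling amounts to bounding [e^-1] itself. *)
rewrite -[leRHS]/(#|F|%:Z%:~R) ler_int ceil_le_int.
by rewrite -[leRHS]invrK lef_pV2// posrE invr_gt0 ltr0n.
Qed.

Theorem theorem5 (R : realType) (n : nat) (W : {set {set 'I_n}})
    (gW : simple_game W) :
  let e := min_max_excess R W in
  let D := price_of_stability R W in
  let q := 1 - e in
  (eceil (1%:E / e%:E) <= nakamura R W)%E /\
  ((eceil ((1 + D)%:E / D%:E) <= nakamura R W)%E /\
   eceil ((1 + D)%:E / D%:E)%E = eceil (1%:E / (1 - q)%:E)%E).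
Proof.
move=> e D q.
have D0 : 0 <= D := price_of_stability_ge0 R gW.
have eE : e = D / (1 + D) := min_max_excessE R gW.
have ratioE : ((1 + D)%:E / D%:E = 1%:E / e%:E)%E.
  (* If [D = 0] then [e = 0] and both quotients are [+oo]; otherwise both are finite. *)
  have [D_eq0|D_neq0] := eqVneq D 0.
    by rewrite eE D_eq0 mul0r !divide0//; lra.
  have D1 : 1 + D != 0 by rewrite gt_eqF//; lra.
  rewrite !inver (negbTE D_neq0) eE mulf_eq0 invr_eq0 (negbTE D1).
  by rewrite (negbTE D_neq0)/= -!EFinM mul1r invf_div.
have qE : 1 - q = e by rewrite subKr.
have nak : (eceil (1%:E / e%:E) <= nakamura R W)%E.
  exact: eceil_inv_min_max_excess_le.
by rewrite qE ratioE.
Qed.
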